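(* Let $n\geq 3$ and let $1,2,\ldots,s_{\delta(n)},s_{\delta(n)+1}=n$ be an addition chain producing $n$ of length $\delta(n)$, with associated generators $2=a_2+r_2$, $s_3=a_3+r_3,\ldots,s_{\delta(n)}=a_{\delta(n)}+r_{\delta(n)},\ s_{\delta(n)+1}=a_{\delta(n)+1}+r_{\delta(n)+1}=n$, where $a_2=r_2=1$ and $a_{i+1}=a_i+r_i$ for $2\leq i\leq\delta(n)$. Then \[\sum_{j=2}^{\delta(n)+1} s_j=2(n-1)+(\delta(n)-1)+a_{\delta(n)}-r_{\delta(n)+1}+\int_{2}^{\delta(n)-1}\sum_{2\leq j\leq t} r_j\,dt.\]
   Context: An addition chain of length $k-1$ producing $n$ is a sequence $1=s_1,2=s_2,\ldots,s_{k-1},s_k=n$ in which each term $s_j$ ($j\geq 3$) is the sum of two earlier terms. In this paper each term is written via a partition $s_i=a_i+r_i$ ($2\leq i\leq k$), called the $i$-th generator, with $2=1+1$ (i.e. $a_2=r_2=1$) and $a_{i+1}=a_i+r_i$; $a_i$ is the determiner and $r_i$ the regulator of the $i$-th generator. Here $k-1=\delta(n)$. The integrand $t\mapsto\sum_{2\leq j\leq t}r_j$ is the step function of the real variable $t$ summing the regulators with integer index $j$ satisfying $2\leq j\leq t$. *)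

(* Defs.v *)
From Stdlib Require Import Reals ZArith.
From Coquelicot Require Import Coquelicot.
Open Scope R_scope.

(** [s 1, ..., s (len + 1)] is an addition chain of length [len] producing [n].
    Terms are indexed from 1; the values of [s] at other indices are irrelevant.
    The two earlier terms need not be distinct, so doublings are allowed. *)
Definition addition_chain (len : nat) (n : Z) (s : nat -> Z) : Prop :=
  (1 <= len)%nat /\
  s 1%nat = 1%Z /\ s 2%nat = 2%Z /\ s (len + 1)%nat = n /\
  forall j : nat, (3 <= j <= len + 1)%nat ->
    exists p q : nat,
      (1 <= p < j)%nat /\ (1 <= q < j)%nat /\ s j = (s p + s q)%Z.

(** The chain is not required to be increasing, hence regulators are allowed
    to be arbitrary integers. *)
Definition generators (len : nat) (s a r : nat -> Z) : Prop :=
  a 2%nat = 1%Z /\ r 2%nat = 1%Z /\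
  (forall i : nat, (2 <= i <= len + 1)%nat -> s i = (a i + r i)%Z) /\
  (forall i : nat, (2 <= i <= len)%nat -> a (i + 1)%nat = (a i + r i)%Z).

(** The sum of [r j] over the integers [2 <= j <= t]. [Int_part] is the floor
    function; for [t < 2] the range is empty and the sum is [0]. *)
Definition regulator_sum (r : nat -> Z) (t : R) : R :=
  sum_n_m (fun j : nat => IZR (r j)) 2 (Z.to_nat (Int_part t)).

(* Main.v *)
(** Write [R k] for the sum of [r 2, ..., r k]. Telescoping gives [s k = 1 + R k], so the
    left-hand side is [delta] plus the sum of [R k] over [2 <= k <= delta + 1]. The integral
    equals the part [k <= delta - 2] of this sum, and the three remaining values are
    [R (delta + 1) = n - 1], [R delta = n - 1 - r (delta + 1)] and
    [R (delta - 1) = a delta - 1]. *)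
Require Import Defs.
From Stdlib Require Import Reals ZArith Lia Lra.
From Coquelicot Require Import Coquelicot.
Open Scope R_scope.

Lemma Int_part_between (k : nat) (t : R) :
  INR k < t < INR (S k) -> Z.to_nat (Int_part t) = k.
Proof.
  rewrite S_INR; intros Ht.
  rewrite <- (Int_part_spec t (Z.of_nat k)); [apply Nat2Z.id|].
  rewrite <- INR_IZR_INZ; lra.
Qed.

(** The integrand is constant on each open unit interval, and its values at the integer endpoints do
    not affect the integral; Chasles glues the pieces. *)
Lemma is_RInt_floor_step (f : nat -> R) (p q : nat) :
  (p <= q)%nat ->
  is_RInt (fun t => f (Z.to_nat (Int_part t))) (INR p) (INR (S q)) (sum_n_m f p q).
Proof.
  assert (unit_step : forall k,
    is_RInt (fun t => f (Z.to_nat (Int_part t))) (INR k) (INR (S k)) (f k)).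
  { intros k.
    apply is_RInt_ext with (fun _ => f k).
    - intros t Ht.
      rewrite Rmin_left, Rmax_right in Ht by (apply le_INR; lia).
      now rewrite (Int_part_between k t Ht).
    - refine (eq_ind _ (is_RInt _ _ _) (is_RInt_const _ _ (f k)) _ _).
      rewrite S_INR; unfold scal; simpl; unfold mult; simpl; ring. }
  induction 1 as [|q Hpq IH].
  - rewrite sum_n_n; apply unit_step.
  - rewrite sum_n_Sm by lia.
    apply (is_RInt_Chasles (V := R_NormedModule)) with (INR (S q)); [exact IH|apply unit_step].
Qed.

(** The recursion on determiners says [a (i + 1) = s i], so each term exceeds its predecessor by its
    own regulator. *)
Lemma generators_term (len : nat) (s a r : nat -> Z) (i : nat) :
  generators len s a r -> (2 <= i <= len + 1)%nat ->
  IZR (s i) = 1 + sum_n_m (fun j => IZR (r j)) 2 i.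
Proof.
  intros (Ha & Hr & Hs & Hstep) [Hi Hlen].
  induction Hi as [|i Hi IH].
  - rewrite (Hs 2%nat), Ha, Hr, sum_n_n, Hr by lia; simpl; lra.
  - rewrite sum_n_Sm, (Hs (S i)), plus_IZR by lia.
    replace (a (S i)) with (s i).
    + rewrite IH by lia; unfold plus; simpl; ring.
    + rewrite <- (Nat.add_1_r i), Hstep by lia; apply Hs; lia.
Qed.

Theorem theorem2p11 (n : Z) (delta : nat) (s a r : nat -> Z)
  (hn : (3 <= n)%Z)
  (hs : addition_chain delta n s)
  (hg : generators delta s a r) :
  sum_n_m (fun j : nat => IZR (s j)) 2 (delta + 1) =
    2 * (IZR n - 1) + (INR delta - 1) + IZR (a delta) - IZR (r (delta + 1)%nat)
    + RInt (fun t : R => regulator_sum r t) 2 (INR delta - 1).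
Proof.
  destruct hs as (Hlen & _ & H2 & Hn & _).
  (* Length 1 would give [n = s 2 = 2], against [3 <= n]. *)
  assert (Hd : exists m, delta = S (S m)).
  { destruct delta as [|[|m]]; [lia| |now exists m].
    simpl in Hn; lia. }
  destruct Hd as [m ->].
  set (P := sum_n_m (fun j => IZR (r j)) 2 : nat -> R).
  assert (P1 : P 1%nat = 0) by (apply (sum_n_m_zero (G := R_AbelianMonoid)); lia).
  (* Starting the integral at 1, where the integrand vanishes on [1, 2), also covers
     [delta = 2], where the bounds 2 and [delta - 1] are reversed. *)
  assert (Hint : RInt (fun t => regulator_sum r t) 2 (INR (S (S m)) - 1) = sum_n_m P 1 m).
  { apply is_RInt_unique.
    replace (INR (S (S m)) - 1) with (INR (S m)) by (rewrite (S_INR (S m)); ring).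
    replace (sum_n_m P 1 m) with (plus (opp (P 1%nat)) (sum_n_m P 1 m))
      by (rewrite P1; unfold plus, opp; simpl; ring).
    apply (is_RInt_Chasles (V := R_NormedModule)) with (INR 1).
    - apply (is_RInt_swap (V := R_NormedModule)).
      rewrite <- (sum_n_n P 1).
      apply (is_RInt_floor_step P 1 1); lia.
    (* For [m = 0] both bounds equal 1 and the sum is empty, a case outside [p <= q]. *)
    - destruct m as [|m].
      + rewrite sum_n_m_zero by lia; apply (is_RInt_point (V := R_NormedModule)).
      + apply (is_RInt_floor_step P 1 (S m)); lia. }
  assert (Hsum : sum_n_m (fun j => IZR (s j)) 2 (S (S m) + 1)
                 = INR (S (S m)) + sum_n_m P 1 (S (S (S m)))).
  { rewrite (sum_n_m_ext_loc _ (fun j => plus 1 (P j)))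
      by (intros k Hk; apply (generators_term _ _ _ _ _ hg); lia).
    (* The constants 1 add up to [delta]; the range of [P] may start at 1 because [P 1 = 0]. *)
    rewrite sum_n_m_plus, sum_n_m_const, (sum_Sn_m P 1), P1 by lia.
    rewrite Nat.add_1_r, Nat.sub_succ, Nat.sub_succ, Nat.sub_0_r.
    unfold plus; simpl; ring. }
  assert (Ha : IZR (a (S (S m))) = 1 + P (S m)).
  { pose proof (generators_term _ _ _ _ (S (S m)) hg ltac:(lia)) as E.
    destruct hg as (_ & _ & Hs & _).
    (* Both expressions for [s delta] contain [r delta], which cancels. *)
    rewrite Hs, plus_IZR, sum_n_Sm in E by lia.
    fold P in E; unfold plus in E; simpl in E; lra. }
  assert (Hlast : IZR n = 1 + P (S (S (S m)))).
  { rewrite <- Hn, Nat.add_1_r.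
    apply (generators_term _ _ _ _ _ hg); lia. }
  assert (HP : P (S (S (S m))) = P (S (S m)) + IZR (r (S (S (S m)))))
    by (apply (sum_n_Sm (G := R_AbelianMonoid)); lia).
  rewrite Hint, Hsum, Ha, Hlast, Nat.add_1_r, !sum_n_Sm by lia.
  unfold plus; simpl AbelianMonoid.plus.
  lra.
Qed.
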